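(* Let $(F,G)=(F(t,x,v),G(t,x,v))$ be a solution of the reduced BGK system $$\partial_t F+v\cdot\nabla_xF=\frac1\tau\bigl(M_{int}[F,G]-F\bigr),\qquad \partial_tG+v\cdot\nabla_xG=\frac1\tau\bigl(e_{int}(T)M_{int}[F,G]-G\bigr),$$ where $$M_{int}[F,G](v)=\frac{\rho}{(2\pi RT)^{3/2}}\exp\Bigl(-\frac{|v-u|^2}{2RT}\Bigr),$$ and $\rho,u,e,T$ are the functions of $(t,x)$ defined by $\rho=\langle F\rangle_v$, $\rho u=\langle vF\rangle_v$, $\rho e=\langle\frac12|v-u|^2F\rangle_v+\langle G\rangle_v$, $T=\mathbb T(e)$. Then the H-theorem holds: $$\partial_t\mathcal H(F,G)+\nabla_x\cdot\langle vH(F,G)\rangle_v\le 0,$$ where $H(F,G)=F\log F-\frac{F}{R}\,s_{int}\!\left(\frac GF\right)$ and $\mathcal H(F,G)=\langle H(F,G)\rangle_v$.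
   Context: Thermodynamics: $R>0$ is a constant. $e_{int}:(0,\infty)\to\mathbb R$ is a $C^1$ function with $c_v^{int}(T)=e_{int}'(T)>0$; $J=e_{int}((0,\infty))$ and $\mathbb T_{int}:J\to(0,\infty)$ is the inverse of $e_{int}$. The total energy is $e(T)=\frac32RT+e_{int}(T)$, strictly increasing, with inverse function $\mathbb T$. $s_{int}:J\to\mathbb R$ is a fixed function with $s_{int}'(\varepsilon)=1/\mathbb T_{int}(\varepsilon)$ (an entropy associated with $e_{int}$, defined up to an additive constant). Notation: $t\ge0$, $x\in\mathbb R^3$, $v\in\mathbb R^3$; $\langle\psi\rangle_v=\int_{\mathbb R^3}\psi\,dv$. $\tau>0$ is a relaxation time (it may depend on $(t,x)$ through the macroscopic quantities). Regularity convention: $F>0$, $G/F$ takes values in $J$, $(F,G)$ is $C^1$, all velocity integrals involved converge absolutely, and derivatives in $t$ and $x$ may be exchanged with integration in $v$. *)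

(* Defs.v *)
From HB Require Import structures.
From mathcomp Require Import all_boot all_order all_algebra.
From mathcomp Require Import all_classical all_reals all_analysis.

Set Implicit Arguments.
Unset Strict Implicit.
Unset Printing Implicit Defensive.

Import Order.TTheory GRing.Theory Num.Theory.
Import numFieldNormedType.Exports.

Local Open Scope classical_set_scope.
Local Open Scope ring_scope.

Section velocity_space.
Context {R : realType}.
Implicit Type psi : 'rV[R]_3 -> R.

(* 'rV[R]_3 carries no measurable structure in the library, so integrals over
   R^3 are taken over R * R * R and transported by vec3. *)
Definition leb2 := (@lebesgue_measure R \x @lebesgue_measure R)%E.

HB.instance Definition _ := Measure.on leb2.

(* The library's canonical sigma-finite structure on a product measure only
   applies to products of finite measures. *)
Lemma leb2_sigma_finite : sigma_finite setT leb2.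
Proof.
have /sigma_finiteP[A [TA ndA Aoo]] := sigma_finiteT (@lebesgue_measure R).
exists (fun n => A n `*` A n).
  rewrite -setXTT TA predeqE => -[x y]; split.
    move=> [/= [n _ Anx] [k _ Aky]]; exists (maxn n k) => //; split.
      by move: x Anx; exact/subsetPset/ndA/leq_maxl.
    by move: y Aky; exact/subsetPset/ndA/leq_maxr.
  by move=> [n _ []/= ? ?]; split; exists n.
move=> k; have [mA Afin] := Aoo k; split; first exact: measurableX.
by rewrite /leb2 product_measure1E// lte_mul_pinfty// ge0_fin_numE.
Qed.

HB.instance Definition _ :=
  Measure_isSigmaFinite.Build _ _ _ leb2 leb2_sigma_finite.

Definition leb3 := (leb2 \x @lebesgue_measure R)%E.

HB.instance Definition _ := Measure.on leb3.

Definition vec3 (p : R * R * R) : 'rV[R]_3 :=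
  \row_(i < 3) [:: p.1.1; p.1.2; p.2]`_i.

Definition vint psi : R := \int[leb3]_(p in setT) psi (vec3 p).

Definition vintegrable psi : Prop :=
  leb3.-integrable setT (fun p => (psi (vec3 p))%:E).

(* Squared Euclidean norm; `|v| on 'rV[R]_3 is the sup norm. *)
Definition sqnorm (v : 'rV[R]_3) : R := \sum_(i < 3) v ord0 i ^+ 2.

End velocity_space.

Section derivatives.
Context {R : realType}.

(* Time derivatives on [0, +oo[: the usual two-sided derivative when t > 0,
   the right derivative at t = 0. *)
Definition tquot (f : R -> R) (t s : R) : R := (f s - f t) / (s - t).

Definition tnear (t : R) : set_system R := within [set s | 0 <= s] t^'.

Definition tderivable (f : R -> R) (t : R) : Prop :=
  cvg (tquot f t s @[s --> tnear t]).

Definition dt (f : R -> R) (t : R) : R := lim (tquot f t s @[s --> tnear t]).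

Definition xderivable (f : 'rV[R]_3 -> R) (x : 'rV[R]_3) (i : 'I_3) : Prop :=
  derivable f x (delta_mx ord0 i).

Definition dx (i : 'I_3) (f : 'rV[R]_3 -> R) (x : 'rV[R]_3) : R :=
  'D_(delta_mx ord0 i) f x.

Implicit Types F psi : R -> 'rV[R]_3 -> 'rV[R]_3 -> R.

Definition continuous_phase psi : Prop :=
  {within [set p : R * 'rV[R]_3 * 'rV[R]_3 | 0 <= p.1.1],
    continuous (fun p => psi p.1.1 p.1.2 p.2)}.

(* C^1 on [0, +oo[ x R^3 x R^3. *)
Definition C1_phase F : Prop :=
  [/\ continuous_phase F,
      forall t x v, 0 <= t ->
        tderivable (fun s => F s x v) t /\
        forall i, xderivable (fun y => F t y v) x i /\
                  xderivable (fun w => F t x w) v i,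
      continuous_phase (fun t x v => dt (fun s => F s x v) t),
      forall i, continuous_phase (fun t x v => dx i (fun y => F t y v) x) &
      forall i, continuous_phase (fun t x v => dx i (fun w => F t x w) v)].

Definition transport F t x v : R :=
  dt (fun s => F s x v) t + \sum_(i < 3) v ord0 i * dx i (fun y => F t y v) x.

Definition exchange_t psi t x : Prop :=
  [/\ vintegrable (fun v => dt (fun s => psi s x v) t),
      tderivable (fun s => vint (psi s x)) t &
      dt (fun s => vint (psi s x)) t = vint (fun v => dt (fun s => psi s x v) t)].

Definition exchange_x i psi t x : Prop :=
  [/\ vintegrable (fun v => dx i (fun y => psi t y v) x),
      xderivable (fun y => vint (psi t y)) x i &
      dx i (fun y => vint (psi t y)) x = vint (fun v => dx i (fun y => psi t y v) x)].

End derivatives.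

Section thermodynamics.
Context {R : realType}.
Variables (Rg : R) (eint : R -> R).

Definition energy_range : set R := eint @` [set T | 0 < T].

Definition inv_pos (f : R -> R) : R -> R := 'pinv_(fun=> 0) [set T | 0 < T] f.

Definition etot (T : R) : R := 3 / 2 * Rg * T + eint T.

Variables f g : 'rV[R]_3 -> R.

Definition density : R := vint f.

Definition velocity : 'rV[R]_3 :=
  \row_(i < 3) (vint (fun v => v ord0 i * f v) / density).

Definition energy : R :=
  (vint (fun v => sqnorm (v - velocity) / 2 * f v) + vint g) / density.

Definition temperature : R := inv_pos etot energy.

Definition Mint (v : 'rV[R]_3) : R :=
  density / (2 * pi * Rg * temperature) `^ (3 / 2)
  * expR (- (sqnorm (v - velocity) / (2 * Rg * temperature))).

Definition Hdens (sint : R -> R) (v : 'rV[R]_3) : R :=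
  f v * ln (f v) - f v / Rg * sint (g v / f v).

End thermodynamics.

Section reduced_BGK.
Context {R : realType}.
Variables (Rg : R) (eint : R -> R).
Variables F G : R -> 'rV[R]_3 -> 'rV[R]_3 -> R.

Definition reduced_BGK (tau : R -> 'rV[R]_3 -> R) : Prop :=
  forall t x v, 0 <= t ->
    transport F t x v = (tau t x)^-1 * (Mint Rg eint (F t x) (G t x) v - F t x v) /\
    transport G t x v =
      (tau t x)^-1 * (eint (temperature Rg eint (F t x) (G t x))
                        * Mint Rg eint (F t x) (G t x) v - G t x v).

(* Absolute convergence of the velocity integrals, and exchange of d/dt and
   d/dx_i with the velocity integral in the entropy and in the entropy flux. *)
Definition regular (sint : R -> R) : Prop :=
  let H t x := Hdens Rg (F t x) (G t x) sint in
  forall t x, 0 <= t ->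
    [/\ vintegrable (F t x) /\ vintegrable (G t x),
        (forall i, vintegrable (fun v => v ord0 i * F t x v)) /\
        vintegrable (fun v => sqnorm (v - velocity (F t x)) / 2 * F t x v),
        vintegrable (H t x) /\ (forall i, vintegrable (fun v => v ord0 i * H t x v)),
        exchange_t H t x &
        forall i, exchange_x i (fun t x v => v ord0 i * H t x v) t x].

End reduced_BGK.

(* Main.v *)
Require Import Defs.
From mathcomp Require Import all_boot all_order all_algebra.
From mathcomp Require Import all_classical all_reals all_analysis.
From mathcomp Require Import measurable_realfun ring lra.
Import Order.TTheory GRing.Theory Num.Theory.
Import numFieldNormedType.Exports.
Local Open Scope classical_set_scope.
Local Open Scope ring_scope.

Set Implicit Arguments.
Unset Strict Implicit.
Unset Printing Implicit Defensive.

(* By the chain rule and the two equations, [dt H + v . grad_x H] is [1 / tau]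
   times the differential of [H] at [(F, G)] applied to [(M - F, e_int(T) M - G)].
   Since [H] is convex, its gradient is monotone, so replacing it by the gradient
   at the local equilibrium [(M, e_int(T) M)] can only increase this expression.
   At equilibrium the gradient is [(a + b |v - u|^2 / 2, b)] with [a], [b]
   independent of [v], so the integral vanishes: [M] has the mass of [F], and
   [(M, e_int(T) M)] the energy of [(F, G)]. This compares the integrands directly
   and never needs the entropy of the equilibrium itself to be integrable. *)

(** * Second moment of the Gaussian function on the line *)

Section gaussian_moments.
Context {R : realType}.
Local Notation mu := (@lebesgue_measure R).

(** Solved for [x ^+ 2 * gauss_fun x], this gives half of the difference between [gauss_fun x] and
    an exact derivative, which is the integration by parts behind the second moment. *)
Lemma is_derive_id_gauss_fun (x : R) :
  is_derive x 1 (fun y : R => y * gauss_fun y)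
    (gauss_fun x - 2 * (x ^+ 2 * gauss_fun x)).
Proof.
have dg : is_derive x 1 (fun y : R => gauss_fun y) (expR (- x ^+ 2) * (- (2 * x))).
  have /is_deriveN h := is_deriveX 2 (is_derive_id x (1 : R)).
  apply: is_derive_eq (is_derive1_comp (is_derive_expR _) h) _.
  by rewrite expr1 /GRing.scale/= mulr1.
have := is_deriveM (is_derive_id x (1:R)) dg.
move=> h; apply: is_derive_eq h _.
by rewrite /gauss_fun /GRing.scale/=; ring.
Qed.

(** The boundary term of the integration by parts. Since [expR (n ^+ 2)] is at least [1 + n ^+ 2],
    the term is at most [n^-1]. *)
Lemma cvg_id_gauss_fun : n%:R * gauss_fun (n%:R : R) @[n --> \oo] --> (0 : R).
Proof.
apply: (@squeeze_cvgr _ _ _ _ (cst 0) (fun n : nat => n%:R^-1 : R)).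
- near=> n; rewrite mulr_ge0 ?ler0n ?gauss_fun_ge0//=.
  have n0 : (0 : R) < n%:R by rewrite ltr0n; near: n; exists 1%N.
  rewrite -ler_pdivlMl// -invfM /gauss_fun expRN lef_pV2 ?posrE ?expR_gt0 ?mulr_gt0//.
  by rewrite (le_trans _ (expR_ge1Dx _))// expr2 ler_wpDl.
- exact: cvg_cst.
- apply/gtr0_cvgV0; last exact: cvgr_idn.
  by near=> n; rewrite ltr0n; near: n; exists 1%N.
Unshelve. all: by end_near. Qed.

Lemma continuous_sqr_gauss_fun : continuous (fun x : R => x ^+ 2 * gauss_fun x).
Proof.
by move=> x; apply: cvgM; [exact: exprn_continuous|exact: continuous_gauss_fun].
Qed.

(** Evenness reduces the integral to the half-line. On [[0, n]], integration by parts leaves half of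
    the Gaussian integral minus half of the boundary term; then [n] tends to infinity. *)
Lemma integral_sqr_gauss_fun :
  (\int[mu]_x (x ^+ 2 * gauss_fun x)%:E)%E = (Num.sqrt pi / 2)%:E.
Proof.
have f0 (x : R) : 0 <= x ^+ 2 * gauss_fun x by rewrite mulr_ge0 ?sqr_ge0 ?gauss_fun_ge0.
have cint n (f : R -> R) : continuous f -> mu.-integrable `[0, n%:R] (EFin \o f).
  move=> cf; apply: continuous_compact_integrable; first exact: segment_compact.
  exact: continuous_subspaceT.
rewrite ge0_symfun_integralT//=; last 2 first.
- exact: continuous_sqr_gauss_fun.
- by move=> x/=; rewrite /gauss_fun sqrrN.
rewrite (_ : [set x | _] = `[0, +oo[%classic); last first.
  by apply/seteqP; split => x/=; rewrite in_itv/= andbT.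
suff -> : (\int[mu]_(x in `[0%R, +oo[) (x ^+ 2 * gauss_fun x)%:E)%E =
    (2^-1 * (Num.sqrt pi / 2))%:E by rewrite -EFinM mulrA divff ?mul1r.
have msg : measurable_fun setT (fun x : R => x ^+ 2 * gauss_fun x).
  by apply: continuous_measurable_fun; exact: continuous_sqr_gauss_fun.
have /cvg_lim <- := @ge0_cvgn_integral R mu _ f0 msg; last by [].
have := @ge0_cvgn_integral R mu _ gauss_fun_ge0 measurable_gauss_fun.
rewrite integral0y_gauss => cg.
apply/cvg_lim => //.
have cb : (n%:R * gauss_fun (n%:R : R))%:E @[n --> \oo] --> 0%:E.
  by apply: cvg_EFin; [exact: nearW|exact: cvg_id_gauss_fun].
(* The expected value is put in the shape of half of the Gaussian limit minus the boundary limit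
   [0], so that the two known limits apply. *)
rewrite (_ : (_ * _)%:E = 2^-1%:E * ((Num.sqrt pi / 2)%:E - 0%:E))%E; last first.
  by rewrite -EFinB subr0.
apply: cvg_trans; last first.
  apply: cvgeZl => //; apply: cvgeB cg _ => //.
  exact: cb.
apply: near_eq_cvg; near=> n.
have n0 : (0 : R) < n%:R by rewrite ltr0n; near: n; exists 1%N.
have ig : mu.-integrable `[0, n%:R] (EFin \o gauss_fun).
  by apply: cint; exact: continuous_gauss_fun.
have isg : mu.-integrable `[0, n%:R] (EFin \o (fun x : R => x ^+ 2 * gauss_fun x)).
  by apply: cint; exact: continuous_sqr_gauss_fun.
have cF : continuous (fun y : R => y * gauss_fun y).
  by move=> x; apply: cvgM; [exact: cvg_id|exact: continuous_gauss_fun].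
have dF (x : R) : derivable (fun y : R => y * gauss_fun y) x 1.
  by have [] := is_derive_id_gauss_fun x.
have /= := @continuous_FTC2 R (fun x => gauss_fun x - 2 * (x ^+ 2 * gauss_fun x))
  (fun y => y * gauss_fun y) 0 n%:R n0.
rewrite mul0r sube0 => FTC.
rewrite /= EFinN -FTC; last 3 first.
- apply: continuous_subspaceT => x; apply: cvgB; first exact: continuous_gauss_fun.
  by apply: cvgM; [exact: cvg_cst|exact: continuous_sqr_gauss_fun].
- split; first by move=> x _; exact: dF.
  + by apply: cvg_at_right_filter; exact: cF.
  + by apply: cvg_at_left_filter; exact: cF.
- by move=> x _; rewrite derive1E; have [_ ->] := is_derive_id_gauss_fun x.
under [X in (_ - X)%E]eq_integral do rewrite EFinB.
rewrite integralB_EFin//; last first.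
  apply: (cint n (fun x => 2 * (x ^+ 2 * gauss_fun x))) => x.
  by apply: cvgM; [exact: cvg_cst|exact: continuous_sqr_gauss_fun].
under [X in (_ - (_ - X))%E]eq_integral do rewrite EFinM.
rewrite integralZl//.
(* Both integrals are finite, so the remaining identity is one between real numbers. *)
have /fineK <- : (\int[mu]_(x in `[0%R, n%:R]) (gauss_fun x)%:E)%E \is a fin_num.
  exact: integrable_fin_num ig.
have /fineK <- : (\int[mu]_(x in `[0%R, n%:R]) (x ^+ 2 * gauss_fun x)%:E)%E
    \is a fin_num.
  exact: integrable_fin_num isg.
by rewrite -!(EFinM,EFinB); congr EFin; field.
Unshelve. all: by end_near. Qed.

End gaussian_moments.

(** * Variance of a normal density *)

Section normal_moments.
Context {R : realType}.
Local Notation mu := (@lebesgue_measure R).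

Lemma ge0_integral_affine (m c : R) (g : R -> R) : 0 < c -> continuous g ->
  (forall x, 0 <= g x) ->
  (\int[mu]_x (g ((x - m) / c))%:E = c%:E * \int[mu]_x (g x)%:E)%E.
Proof.
move=> c0 cg g0; pose F (x : R^o) : R^o := (x - m) / c.
have dF (x : R) : is_derive x 1 F c^-1.
  have -> : F = c^-1 *: (id - cst m) :> (R -> R).
    by apply/funext => y; rewrite /F/= mulrC.
  by apply: is_derive_eq; rewrite subr0 /GRing.scale/= mulr1.
have F'E : F^`()%classic = cst c^-1.
  by apply/funext => x; rewrite derive1E; have [_ ->] := dF x.
have mgF : measurable_fun [set: R] (g \o F).
  apply: measurableT_comp; first exact: continuous_measurable_fun.
  by apply: measurable_funM => //; exact: measurable_funB.
rewrite (@increasing_ge0_integration_by_substitutionT _ F g)//; last 6 first.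
- by move=> x y xy; rewrite /F ltr_pM2r ?ltrD2r ?invr_gt0.
- by rewrite F'E => ?; exact: cvg_cst.
- by rewrite F'E; exact: is_cvg_cst.
- by rewrite F'E; exact: is_cvg_cst.
- by apply/gt0_cvgMlNy; [rewrite invr_gt0|exact: cvg_addrr_Ny].
- by apply/gt0_cvgMly; [rewrite invr_gt0|exact: cvg_addrr].
rewrite -ge0_integralZl//=; last 3 first.
- apply/measurable_EFinP; rewrite F'E; apply: measurable_funM.
  + exact: mgF.
  + exact: measurable_cst.
- by move=> x _; rewrite lee_fin F'E; apply: mulr_ge0 => /=;
    rewrite ?g0 ?invr_ge0 ?(ltW c0).
- by rewrite lee_fin ltW.
by apply: eq_integral => x _; rewrite F'E/= -EFinM /= mulrCA divff ?mulr1 ?gt_eqF.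
Qed.

Lemma integral_sqr_normal_pdf (m s : R) : 0 < s ->
  (\int[mu]_x ((x - m) ^+ 2 * normal_pdf m s x)%:E = (s ^+ 2)%:E)%E.
Proof.
(* With [c] equal to [s] times the square root of 2, the exponent [(x - m) ^+ 2 / (2 * s ^+ 2)]
   becomes [((x - m) / c) ^+ 2], the one in [gauss_fun]. *)
move=> s0; pose c := Num.sqrt (s ^+ 2 *+ 2).
have c0 : 0 < c by rewrite sqrtr_gt0 pmulrn_lgt0// exprn_gt0.
have c2 : c ^+ 2 = s ^+ 2 * 2 by rewrite sqr_sqrtr ?mulr_natr// mulrn_wge0 ?sqr_ge0.
have sp0 : 0 < Num.sqrt pi :> R by rewrite sqrtr_gt0 pi_gt0.
have pk : normal_peak s = (c * Num.sqrt pi)^-1.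
  by rewrite /normal_peak -mulrnAl sqrtrM// pmulrn_lge0// sqr_ge0.
have E x : (x - m) ^+ 2 * normal_pdf m s x =
    (normal_peak s * c ^+ 2) * (((x - m) / c) ^+ 2 * gauss_fun ((x - m) / c)).
  rewrite normal_pdfE ?gt_eqF// /normal_fun /gauss_fun exprMn exprVn.
  by rewrite -mulr_natr -c2 mulNr; field; exact: lt0r_neq0.
under eq_integral do rewrite E EFinM.
have k0 : 0 <= normal_peak s * c ^+ 2 by rewrite mulr_ge0 ?normal_peak_ge0 ?sqr_ge0.
rewrite ge0_integralZl//; last 2 first.
- apply/measurable_EFinP.
  apply: (@measurableT_comp _ _ _ _ _ _ (fun x : R => x ^+ 2 * gauss_fun x)).
    by apply: continuous_measurable_fun; exact: continuous_sqr_gauss_fun.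
  by apply: measurable_funM => //; exact: measurable_funB.
- by move=> x _; rewrite lee_fin mulr_ge0 ?sqr_ge0 ?gauss_fun_ge0.
rewrite (@ge0_integral_affine m c (fun x => x ^+ 2 * gauss_fun x))//; last 2 first.
- exact: continuous_sqr_gauss_fun.
- by move=> x; rewrite mulr_ge0 ?sqr_ge0 ?gauss_fun_ge0.
rewrite integral_sqr_gauss_fun -!EFinM pk c2; congr EFin.
by field; rewrite !gt_eqF.
Qed.

End normal_moments.

(** * Tonelli's theorem for products of functions of separate coordinates *)

Section product.
Context {R : realType}.

Lemma ge0_integral_prod d1 d2 (T1 : measurableType d1) (T2 : measurableType d2)
    (m1 : {sigma_finite_measure set T1 -> \bar R})
    (m2 : {sigma_finite_measure set T2 -> \bar R}) (f : T1 -> R) (g : T2 -> R) :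
  measurable_fun setT f -> measurable_fun setT g ->
  (forall x, 0 <= f x) -> (forall y, 0 <= g y) ->
  (\int[(m1 \x m2)%E]_z (f z.1 * g z.2)%:E
   = \int[m1]_x (f x)%:E * \int[m2]_y (g y)%:E)%E.
Proof.
move=> mf mg f0 g0; rewrite fubini_tonelli1//=; last 2 first.
- apply/measurable_EFinP; apply: measurable_funM; exact: measurableT_comp.
- by move=> z; rewrite lee_fin mulr_ge0.
rewrite -ge0_integralZr//; last 3 first.
- exact/measurable_EFinP.
- by move=> x _; rewrite lee_fin.
- by apply: integral_ge0 => y _; rewrite lee_fin.
apply: eq_integral => x _; rewrite /fubini_F/=.
under eq_integral do rewrite EFinM.
rewrite ge0_integralZl// ?lee_fin//; first exact/measurable_EFinP.
by move=> y _; rewrite lee_fin.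
Qed.

Lemma ge0_integral_leb3 (f g h : R -> R) :
  measurable_fun setT f -> measurable_fun setT g -> measurable_fun setT h ->
  (forall x, 0 <= f x) -> (forall x, 0 <= g x) -> (forall x, 0 <= h x) ->
  (\int[leb3]_p (f p.1.1 * g p.1.2 * h p.2)%:E =
   \int[lebesgue_measure]_x (f x)%:E * \int[lebesgue_measure]_x (g x)%:E *
   \int[lebesgue_measure]_x (h x)%:E)%E.
Proof.
move=> mf mg mh f0 g0 h0.
rewrite /leb3 (@ge0_integral_prod _ _ _ _ leb2 lebesgue_measure
  (fun p => f p.1 * g p.2) h)//; last 2 first.
- by apply: measurable_funM; exact: measurableT_comp.
- by move=> x; rewrite mulr_ge0.
by congr (_ * _)%E; rewrite /leb2 ge0_integral_prod.
Qed.
End product.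

(** * Linearity, monotonicity and strict positivity of velocity integrals *)

Section velocity_integrals.
Context {R : realType}.
Implicit Types psi phi : 'rV[R]_3 -> R.
Local Notation mu := (@lebesgue_measure R).

Lemma vec3E (p : R * R * R) :
  (vec3 p ord0 0 = p.1.1) * (vec3 p ord0 1 = p.1.2) * (vec3 p ord0 2 = p.2).
Proof. by rewrite /vec3 !mxE. Qed.

Lemma sum3E (f : 'I_3 -> R) : \sum_(i < 3) f i = f 0 + f 1 + f 2.
Proof.
rewrite !big_ord_recr big_ord0 /= add0r.
by congr (f _ + f _ + f _); exact: val_inj.
Qed.

Lemma vintegrableD psi phi : vintegrable psi -> vintegrable phi ->
  vintegrable (fun v => psi v + phi v).
Proof. exact: integrableD. Qed.

Lemma vintegrableZ (k : R) psi : vintegrable psi ->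
  vintegrable (fun v => k * psi v).
Proof. exact: integrableZl. Qed.

Lemma vintegrable_sum (I : Type) (s : seq I) (f : I -> 'rV[R]_3 -> R) :
  (forall i, vintegrable (f i)) -> vintegrable (fun v => \sum_(i <- s) f i v).
Proof.
move=> fi; elim: s => [|i s IH].
  by rewrite /vintegrable; under eq_fun do rewrite big_nil; exact: integrable0.
rewrite /vintegrable; under eq_fun do rewrite big_cons.
exact: (vintegrableD (fi i) IH).
Qed.

Lemma vintD psi phi : vintegrable psi -> vintegrable phi ->
  vint (fun v => psi v + phi v) = vint psi + vint phi.
Proof. by move=> ? ?; rewrite /vint RintegralD. Qed.

Lemma vintZ (k : R) psi : vintegrable psi ->
  vint (fun v => k * psi v) = k * vint psi.
Proof. by move=> ?; rewrite /vint RintegralZl. Qed.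

Lemma vint_sum (I : Type) (s : seq I) (f : I -> 'rV[R]_3 -> R) :
  (forall i, vintegrable (f i)) ->
  vint (fun v => \sum_(i <- s) f i v) = \sum_(i <- s) vint (f i).
Proof.
move=> fi; elim: s => [|i s IH].
  rewrite /vint; under eq_Rintegral do rewrite big_nil.
  by rewrite big_nil /Rintegral integral0.
rewrite /vint; under eq_Rintegral do rewrite big_cons.
by rewrite big_cons -IH -vintD//; exact: vintegrable_sum.
Qed.

Lemma le_vint psi phi : vintegrable psi -> vintegrable phi ->
  (forall v, psi v <= phi v) -> vint psi <= vint phi.
Proof. by move=> ? ? h; apply: le_Rintegral => // p _; exact: h. Qed.

(** The total mass is the integral of a product of three constants [1], hence a product of three
    infinite lengths. It keeps the strict positivity of integrals from failing trivially. *)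
Lemma leb3_setT_neq0 : leb3 [set: R * R * R] != 0%E.
Proof.
have -> : leb3 [set: R * R * R] =
    (\int[leb3]_p (cst 1 p.1.1 * cst 1 p.1.2 * cst 1 p.2 : R)%:E)%E.
  by under eq_integral do rewrite /= !mulr1; rewrite integral_cst// mul1e.
rewrite ge0_integral_leb3//= integral_cst//= mul1e.
have -> : mu [set: R] = +oo%E.
  by rewrite -set_itvNyy lebesgue_measure_itv.
by rewrite !mulyy.
Qed.

Lemma set1_triple (x y z : R) :
  [set (x, y, z)] = ([set x] `*` [set y]) `*` [set z].
Proof. by apply/seteqP; split => [_ ->//|[[a b] c] [[/= -> ->] ->]]. Qed.

Lemma measurable_set1_leb3 (p : R * R * R) : measurable [set p].
Proof.
case: p => [[x y] z]; rewrite set1_triple.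
by apply: measurableX => //; exact: measurableX.
Qed.

Lemma leb3_set1 (p : R * R * R) : leb3 [set p] = 0%E.
Proof.
case: p => [[x y] z]; rewrite set1_triple.
rewrite /leb3 product_measure1E//; last exact: measurableX.
exact: (etrans (congr1 (mule _) (lebesgue_measure_set1 z)) (mule0 _)).
Qed.

(** If the integral were zero, [psi] would vanish almost everywhere, and the whole space would be a
    null set together with one point. The exceptional point serves [sqnorm (v - u)], which vanishes
    at [u]. *)
Lemma vint_gt0_except (u : 'rV[R]_3) psi : vintegrable psi ->
  (forall v, 0 <= psi v) -> (forall v, v != u -> 0 < psi v) -> 0 < vint psi.
Proof.
move=> ipsi psi_ge0 psi_gt0; rewrite lt_neqAle Rintegral_ge0 ?andbT//.
apply/eqP => /esym psi_eq0.
have : (\int[leb3]_p `|(psi (vec3 p))%:E| = 0)%E.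
  under eq_integral do rewrite gee0_abs ?lee_fin//.
  by rewrite -[LHS]fineK ?(integrable_fin_num _ ipsi)//; congr EFin.
move/ae_eq_integral_abs => /(_ measurableT (measurable_int _ ipsi)).
move=> [N [mN N0 sub]].
pose p0 := (u ord0 0, u ord0 1, u ord0 2).
have NT : setT = N `|` [set p0].
  apply/seteqP; split=> // p _; have [<-|pp0] := eqVneq p p0; first by right.
  left; apply: sub => /= /(_ I) [] /eqP; rewrite gt_eqF//; apply: psi_gt0.
  apply: contra pp0 => /eqP pu; rewrite /p0 -pu !vec3E.
  by rewrite -!surjective_pairing.
have := leb3_setT_neq0.
rewrite NT measureU0 ?N0 ?eqxx//; first exact: measurable_set1_leb3.
exact: leb3_set1.
Qed.

Lemma vint_gt0 psi : vintegrable psi -> (forall v, 0 < psi v) -> 0 < vint psi.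
Proof.
by move=> ipsi psi0; apply: (@vint_gt0_except 0) => // v; exact: ltW.
Qed.

Lemma vint_prod (f g h : R -> R) (a b c : R) :
  measurable_fun setT f -> measurable_fun setT g -> measurable_fun setT h ->
  (forall x, 0 <= f x) -> (forall x, 0 <= g x) -> (forall x, 0 <= h x) ->
  (\int[mu]_x (f x)%:E = a%:E)%E -> (\int[mu]_x (g x)%:E = b%:E)%E ->
  (\int[mu]_x (h x)%:E = c%:E)%E ->
  let psi := fun v : 'rV[R]_3 => f (v ord0 0) * g (v ord0 1) * h (v ord0 2) in
  vintegrable psi /\ vint psi = a * b * c.
Proof.
move=> mf mg mh f0 g0 h0 fa gb hc psi.
have E : (\int[leb3]_p (psi (vec3 p))%:E = (a * b * c)%:E)%E.
  under eq_integral do rewrite /psi !vec3E.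
  by rewrite ge0_integral_leb3// fa gb hc.
split; last by rewrite /vint /Rintegral E.
have mpsi : measurable_fun setT (fun p : R * R * R => psi (vec3 p)).
  under eq_fun do rewrite /psi !vec3E.
  have m1 : measurable_fun setT (fst : R * R * R -> R * R) by [].
  apply: measurable_funM; first apply: measurable_funM.
  - by apply: (measurableT_comp mf); exact: measurableT_comp.
  - by apply: (measurableT_comp mg); exact: measurableT_comp.
  - exact: measurableT_comp.
apply/integrableP; split; first exact/measurable_EFinP.
under eq_integral do rewrite gee0_abs ?lee_fin ?mulr_ge0//.
by rewrite E ltry.
Qed.

End velocity_integrals.

(** * Mass and second moment of a Maxwellian *)

Section maxwellian_moments.
Context {R : realType}.
Variables (rho theta : R) (u : 'rV[R]_3).
Hypothesis theta0 : 0 < theta.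
Local Notation mu := (@lebesgue_measure R).

(** Here [theta] stands for the product of the gas constant and the temperature, and the parameters
    are free of the distribution that will determine them. *)
Definition maxwellian (v : 'rV[R]_3) : R :=
  rho / (2 * pi * theta) `^ (3 / 2) * expR (- (sqnorm (v - u) / (2 * theta))).

Let sigma := Num.sqrt theta.

Let sigma0 : 0 < sigma. Proof. by rewrite sqrtr_gt0. Qed.

Let sigma2 : sigma ^+ 2 = theta. Proof. by rewrite sqr_sqrtr ?ltW. Qed.

Let pdf (i : 'I_3) := normal_pdf (u ord0 i) sigma.

Let pdf_ge0 i x : 0 <= pdf i x. Proof. exact: normal_pdf_ge0. Qed.

Let measurable_pdf i : measurable_fun setT (pdf i).
Proof. exact: measurable_normal_pdf. Qed.

Let sqpdf (i : 'I_3) x := (x - u ord0 i) ^+ 2 * pdf i x.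

Let sqpdf_ge0 i x : 0 <= sqpdf i x. Proof. by rewrite mulr_ge0 ?sqr_ge0. Qed.

Let measurable_sqpdf i : measurable_fun setT (sqpdf i).
Proof.
apply: measurable_funM; last exact: measurable_pdf.
by apply: measurable_funX; exact: measurable_funB.
Qed.

Let int_pdf i : (\int[mu]_x (pdf i x)%:E = 1%:E)%E.
Proof. exact: integral_normal_pdf. Qed.

Let int_sqpdf i : (\int[mu]_x (sqpdf i x)%:E = theta%:E)%E.
Proof. by rewrite /sqpdf/pdf integral_sqr_normal_pdf// sigma2. Qed.

(** The exponential of a sum of squares factors over the coordinates, and the power [3 / 2] is the
    cube of the square root in each normalising constant. The factors are normal densities of
    variance [theta]. *)
Lemma maxwellian_prod v : maxwellian v =
  rho * (pdf 0 (v ord0 0) * pdf 1 (v ord0 1) * pdf 2 (v ord0 2)).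
Proof.
rewrite /maxwellian /pdf !normal_pdfE ?gt_eqF// /normal_fun /normal_peak sigma2.
have a0 : 0 < 2 * pi * theta by rewrite !mulr_gt0 ?pi_gt0.
have -> : (2 * pi * theta) `^ (3 / 2) = Num.sqrt (theta * pi *+ 2) ^+ 3.
  rewrite [3 / 2]mulrC powRrM powR12_sqrt ?ltW// powR_mulrn ?sqrtr_ge0//.
  by rewrite (_ : 2 * pi * theta = theta * pi *+ 2)// -mulr_natr; ring.
have s0 : Num.sqrt (theta * pi *+ 2) != 0.
  by rewrite gt_eqF// sqrtr_gt0 mulrn_wgt0// mulr_gt0 ?pi_gt0.
have -> : expR (- (sqnorm (v - u) / (2 * theta))) =
   expR (- (v ord0 0 - u ord0 0) ^+ 2 / (theta *+ 2)) *
   expR (- (v ord0 1 - u ord0 1) ^+ 2 / (theta *+ 2)) *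
   expR (- (v ord0 2 - u ord0 2) ^+ 2 / (theta *+ 2)).
  rewrite -!expRD; congr expR; rewrite /sqnorm sum3E !mxE -mulr_natr.
  by field; rewrite gt_eqF.
by field.
Qed.

Lemma vint_maxwellian : vintegrable maxwellian /\ vint maxwellian = rho.
Proof.
have [i e] := vint_prod (measurable_pdf 0) (measurable_pdf 1) (measurable_pdf 2)
  (pdf_ge0 0) (pdf_ge0 1) (pdf_ge0 2) (int_pdf 0) (int_pdf 1) (int_pdf 2).
rewrite (funext maxwellian_prod); split; first exact: vintegrableZ.
by rewrite vintZ// e; ring.
Qed.

(** The squared norm splits into three squares, and each term integrates to one variance [theta]
    times two unit masses. *)
Lemma vint_sqnorm_maxwellian :
  let psi := fun v => sqnorm (v - u) * maxwellian v in
  vintegrable psi /\ vint psi = 3 * rho * theta.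
Proof.
pose psi (v : 'rV[R]_3) := rho * (sqpdf 0 (v ord0 0) * pdf 1 (v ord0 1) * pdf 2 (v ord0 2)
  + pdf 0 (v ord0 0) * sqpdf 1 (v ord0 1) * pdf 2 (v ord0 2)
  + pdf 0 (v ord0 0) * pdf 1 (v ord0 1) * sqpdf 2 (v ord0 2)).
rewrite (_ : (fun v => _) = psi); last first.
  apply/funext => v; rewrite maxwellian_prod /psi /sqpdf /sqnorm sum3E !mxE.
  by ring.
have [i0 e0] := vint_prod (measurable_sqpdf 0) (measurable_pdf 1) (measurable_pdf 2)
  (sqpdf_ge0 0) (pdf_ge0 1) (pdf_ge0 2) (int_sqpdf 0) (int_pdf 1) (int_pdf 2).
have [i1 e1] := vint_prod (measurable_pdf 0) (measurable_sqpdf 1) (measurable_pdf 2)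
  (pdf_ge0 0) (sqpdf_ge0 1) (pdf_ge0 2) (int_pdf 0) (int_sqpdf 1) (int_pdf 2).
have [i2 e2] := vint_prod (measurable_pdf 0) (measurable_pdf 1) (measurable_sqpdf 2)
  (pdf_ge0 0) (pdf_ge0 1) (sqpdf_ge0 2) (int_pdf 0) (int_pdf 1) (int_sqpdf 2).
have i01 := vintegrableD i0 i1; have i012 := vintegrableD i01 i2.
split; first exact: vintegrableZ.
by rewrite /psi vintZ// vintD// vintD// e0 e1 e2; ring.
Qed.

Lemma maxwellian_gt0 v : 0 < rho -> 0 < maxwellian v.
Proof.
by move=> rho0; rewrite mulr_gt0 ?expR_gt0// divr_gt0// powR_gt0// !mulr_gt0 ?pi_gt0.
Qed.

Lemma ln_maxwellian v : 0 < rho ->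
  ln (maxwellian v) =
  ln (rho / (2 * pi * theta) `^ (3 / 2)) - sqnorm (v - u) / (2 * theta).
Proof.
move=> rho0; rewrite /maxwellian lnM ?posrE ?expR_gt0 ?expRK//.
by rewrite divr_gt0// powR_gt0// !mulr_gt0 ?pi_gt0.
Qed.

End maxwellian_moments.

(** * Increasing functions on the positive half-line: inverse, range and entropy *)

Section positive_inverse.
Context {R : realType}.
Variable f : R -> R.
Hypothesis df : forall x : R, 0 < x -> derivable f x 1.
Hypothesis df_gt0 : forall x : R, 0 < x -> 0 < f^`()%classic x.

Let cf (a b : R) : 0 < a -> {within `[a, b], continuous f}.
Proof.
move=> a0; apply: derivable_within_continuous => x.
by rewrite in_itv/= => /andP[ax _]; apply: df; exact: lt_le_trans ax.
Qed.

Lemma ltr_pos_derive1 (a b : R) : 0 < a -> a < b -> f a < f b.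
Proof.
move=> a0 ab.
have [x|c] := @MVT R f f^`()%classic a b ab _ (@cf _ _ a0).
  rewrite in_itv/= => /andP[ax _]; rewrite derive1E.
  by apply/derivableP/df; exact: lt_trans ax.
rewrite in_itv/= => /andP[ac _] E.
by rewrite -subr_gt0 E mulr_gt0 ?subr_gt0// df_gt0// (lt_trans a0).
Qed.

Lemma inv_posK (x : R) : 0 < x -> inv_pos f (f x) = x.
Proof.
move=> x0; apply: (@pinvKV _ _ _ [set T | 0 < T] f); last by rewrite inE.
move=> a b; rewrite !inE/= => a0 b0 fab.
case: (ltgtP a b) => // h.
  by have := ltr_pos_derive1 a0 h; rewrite fab ltxx.
by have := ltr_pos_derive1 b0 h; rewrite fab ltxx.
Qed.

Lemma inv_pos_range e : energy_range f e -> 0 < inv_pos f e /\ f (inv_pos f e) = e.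
Proof. by case=> x x0 <-; rewrite inv_posK. Qed.

(** Intermediate value theorem, applied on whichever of [[a, b]] and [[b, a]] is a genuine
    segment. *)
Lemma energy_range_itv (a b e : R) : 0 < a -> 0 < b -> f a <= e <= f b ->
  energy_range f e.
Proof.
move=> a0 b0 /andP[ae eb]; case: (leP a b) => [ab|/ltW ba].
- have [|c] := @IVT R f a b e ab (@cf _ _ a0).
    by rewrite ge_min ae le_max eb orbT.
  rewrite in_itv/= => /andP[ac _] fc; exists c => //=; exact: lt_le_trans ac.
- have [|c] := @IVT R f b a e ba (@cf _ _ b0).
    by rewrite ge_min ae orbT le_max eb.
  rewrite in_itv/= => /andP[ac _] fc; exists c => //=; exact: lt_le_trans ac.
Qed.

(* The tangent inequality for the concave function [s]; going through [s \o f]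
   puts the mean value theorem on positive numbers, not on the range of [f]. *)
Lemma entropy_tangent (s : R -> R) (a b : R) :
  (forall e, energy_range f e -> is_derive e 1 s (inv_pos f e)^-1) ->
  0 < a -> 0 < b -> s (f b) - s (f a) <= (f b - f a) / a.
Proof.
move=> ds a0 b0.
(* The derivative of [h] is that of [f] times [x^-1 - a^-1], positive before [a] and negative after
   it. So [h] is largest at [a], and the claim is [h b <= h a]. *)
pose h (x : R) := s (f x) - f x * a^-1.
have dh (x : R) : 0 < x -> is_derive x 1 h (f^`()%classic x * (x^-1 - a^-1)).
  move=> x0; have dfx : is_derive x 1 f (f^`()%classic x).
    by rewrite derive1E; exact/derivableP/df.
  have : is_derive (f x) 1 s x^-1.
    by have := ds (f x); rewrite inv_posK//; apply; exists x.
  move=> /is_derive1_comp /(_ dfx) d1.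
  have -> : h = (s \o f) - a^-1 *: f :> (R -> R).
    by apply/funext => y; rewrite /h/= mulrC.
  by apply: is_derive_eq; rewrite /GRing.scale/=; ring.
have ch c d : 0 < c -> {within `[c, d], continuous h}.
  move=> c0; apply: derivable_within_continuous => x.
  rewrite in_itv/= => /andP[cx _].
  by have [] := dh x (lt_le_trans c0 cx).
suff : h b <= h a by rewrite /h mulrBl; lra.
case: (ltgtP a b) => [ab|ba|->//].
- have [x|c] := @MVT R h (fun x => f^`()%classic x * (x^-1 - a^-1)) a b ab _ (@ch _ _ a0).
    by rewrite in_itv/= => /andP[ax _]; apply: dh; exact: lt_trans ax.
  rewrite in_itv/= => /andP[ac _] E; have c0 := lt_trans a0 ac.
  rewrite -subr_le0 E mulr_le0_ge0 ?subr_ge0 ?(ltW ab)//.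
  by rewrite mulr_ge0_le0 ?(ltW (df_gt0 c0))// subr_le0 lef_pV2 ?posrE// ltW.
- have [x|c] := @MVT R h (fun x => f^`()%classic x * (x^-1 - a^-1)) b a ba _ (@ch _ _ b0).
    by rewrite in_itv/= => /andP[ax _]; apply: dh; exact: lt_trans ax.
  rewrite in_itv/= => /andP[bc ca] E; have c0 := lt_trans b0 bc.
  rewrite -subr_ge0 E mulr_ge0 ?subr_ge0 ?(ltW ba)//.
  by rewrite mulr_ge0 ?(ltW (df_gt0 c0))// subr_ge0 lef_pV2 ?posrE// ltW.
Qed.

(* The range is an interval, so a value [m] outside it lies strictly on one side
   of it, and then [m F - G] has constant sign. *)
Lemma energy_range_mean (F G : 'rV[R]_3 -> R) :
  vintegrable F -> vintegrable G -> (forall v, 0 < F v) ->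
  (forall v, energy_range f (G v / F v)) -> energy_range f (vint G / vint F).
Proof.
move=> iF iG F0 GF; set m := vint G / vint F.
have rho0 : 0 < vint F by exact: vint_gt0.
have mG : vint G = m * vint F by rewrite divfK ?gt_eqF.
apply: contrapT => Nm.
have [[a a0 am]|noa] := pselect (exists2 a, 0 < a & f a < m).
- have lt_m b : 0 < b -> f b < m.
    move=> b0; rewrite ltNge; apply/negP => mb; apply: Nm.
    by apply: (energy_range_itv a0 b0); rewrite (ltW am).
  have iF' : vintegrable (fun v => m * F v) by exact: vintegrableZ.
  have iG' : vintegrable (fun v => -1 * G v) by exact: vintegrableZ.
  (* The integrand is positive everywhere, yet its integral is [m * vint F - vint G], which is zero
     by the choice of [m]. *)
  have : 0 < vint (fun v => m * F v + -1 * G v).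
    apply: vint_gt0; first exact: vintegrableD.
    move=> v; have [b b0 fb] := GF v.
    by rewrite mulN1r subr_gt0 -ltr_pdivrMr// -fb lt_m.
  by rewrite vintD// !vintZ// mG mulN1r subrr ltxx.
- have gt_m b : 0 < b -> m < f b.
    move=> b0; rewrite lt_neqAle leNgt; apply/andP; split; last first.
      by apply/negP => ?; apply: noa; exists b.
    by apply/eqP => mb; apply: Nm; exists b.
  have iF' : vintegrable (fun v => - m * F v) by exact: vintegrableZ.
  have : 0 < vint (fun v => G v + - m * F v).
    apply: vint_gt0; first exact: vintegrableD.
    move=> v; have [b b0 fb] := GF v.
    by rewrite mulNr subr_gt0 -ltr_pdivlMr// -fb gt_m.
  by rewrite vintD// vintZ// mG mulNr subrr ltxx.
Qed.

End positive_inverse.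

(** * Sign of the entropy production of a single velocity distribution *)

Section local_equilibrium.
Context {R : realType}.
Variables (Rg : R) (eint : R -> R).
Hypothesis Rg0 : 0 < Rg.
Hypothesis deint : forall T : R, 0 < T -> derivable eint T 1.
Hypothesis cv_gt0 : forall T : R, 0 < T -> 0 < derive1 eint T.
Variables f g : 'rV[R]_3 -> R.
Hypothesis f0 : forall v, 0 < f v.
Hypothesis gf : forall v, energy_range eint (g v / f v).
Hypothesis intf : vintegrable f.
Hypothesis intg : vintegrable g.
Let u := velocity f.
Hypothesis intE : vintegrable (fun v => sqnorm (v - u) / 2 * f v).

Let is_derive_etot (T : R) : 0 < T ->
  is_derive T 1 (etot Rg eint) (3 / 2 * Rg + derive1 eint T).
Proof.
move=> T0; have dT : is_derive T 1 eint (derive1 eint T).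
  by rewrite derive1E; exact/derivableP/deint.
have -> : etot Rg eint = (3 / 2 * Rg) *: id + eint :> (R -> R) by [].
by apply: is_derive_eq; rewrite /GRing.scale/= mulr1.
Qed.

Lemma derivable_etot (T : R) : 0 < T -> derivable (etot Rg eint) T 1.
Proof. by move=> /is_derive_etot[]. Qed.

Lemma derive1_etot_gt0 (T : R) : 0 < T -> 0 < derive1 (etot Rg eint) T.
Proof.
move=> T0; rewrite derive1E; have [_ ->] := is_derive_etot T0.
by rewrite addr_gt0 ?cv_gt0// mulr_gt0.
Qed.

Lemma sqnorm_gt0 (v : 'rV[R]_3) : v != 0 -> 0 < sqnorm v.
Proof.
move=> v0; rewrite lt_neqAle sumr_ge0 ?andbT; last by move=> i _; exact: sqr_ge0.
apply: contra v0; rewrite eq_sym psumr_eq0; last by move=> i _; exact: sqr_ge0.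
move=> /allP v0; apply/eqP/rowP => i; rewrite mxE; apply/eqP.
by have := v0 i (mem_index_enum _); rewrite sqrf_eq0.
Qed.

Let rho0 : 0 < density f. Proof. exact: vint_gt0. Qed.

(** The point is that [energy f g] lies in the range of [etot]. Its kinetic part is [3 / 2 * Rg * a]
    and its internal part [eint b] for some positive [a] and [b]; by monotonicity it lies between
    [etot a] and [etot b]. *)
Lemma temperatureP : 0 < temperature Rg eint f g /\
  etot Rg eint (temperature Rg eint f g) = energy f g.
Proof.
apply: (inv_pos_range derivable_etot derive1_etot_gt0).
have K0 : 0 < vint (fun v => sqnorm (v - u) / 2 * f v).
  apply: (@vint_gt0_except _ u) => // v.
    by rewrite mulr_ge0 ?(ltW (f0 v))// divr_ge0// sumr_ge0// => i _; exact: sqr_ge0.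
  by move=> vu; rewrite mulr_gt0// divr_gt0// sqnorm_gt0// subr_eq0.
rewrite /energy -/u; set K := vint _ in K0 *.
have [b b0 eb] := energy_range_mean deint intf intg f0 gf.
(* The temperature at which [3 / 2 * Rg * a] equals the kinetic energy per unit mass. *)
pose a := 2 / 3 * (K / density f / Rg).
have a0 : 0 < a by rewrite mulr_gt0// !divr_gt0.
have -> : (K + vint g) / density f = 3 / 2 * Rg * a + eint b.
  by rewrite mulrDl -eb /a; field; rewrite !gt_eqF.
have incr x y : 0 < x -> x <= y -> eint x <= eint y.
  move=> x0; rewrite le_eqVlt => /predU1P[->//|xy].
  exact/ltW/(ltr_pos_derive1 deint cv_gt0).
have k0 : 0 <= 3 / 2 * Rg by rewrite mulr_ge0// ltW.
case: (leP a b) => [ab|/ltW ba].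
- apply: (energy_range_itv derivable_etot a0 b0).
  by rewrite /etot lerD2l incr// lerD2r ler_wpM2l.
- apply: (energy_range_itv derivable_etot b0 a0).
  by rewrite /etot lerD2l incr// lerD2r ler_wpM2l.
Qed.

Let T := temperature Rg eint f g.
Let e := eint T.
Let M := Mint Rg eint f g.

Let T0 : 0 < T. Proof. by have [] := temperatureP. Qed.

Let RT0 : 0 < Rg * T. Proof. exact: mulr_gt0. Qed.

Lemma MintE : M = maxwellian (density f) (Rg * T) u.
Proof. by apply/funext => v; rewrite /M /Mint /maxwellian !mulrA. Qed.

Variable sint : R -> R.
Hypothesis dsint : forall eps : R, energy_range eint eps ->
  is_derive eps 1 sint (inv_pos eint eps)^-1.

(** The differential of [F log F - (F / R) s_int(G / F)] at [(f, g)], applied to the relaxation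
    increment [(M - f, e * M - g)]. The coefficient of the second component is [- (Rg * th)^-1]. *)
Definition entropy_production (v : 'rV[R]_3) : R :=
  let eps := g v / f v in let th := inv_pos eint eps in
  (ln (f v) + 1 - sint eps / Rg + eps / (Rg * th)) * (M v - f v)
  - (e * M v - g v) / (Rg * th).

(** The same increment, with the gradient now taken at [(M, e * M)], where the ratio is [e] and the
    internal temperature is [T]. *)
Let equilibrium_production (v : 'rV[R]_3) : R :=
  (ln (M v) + 1 - sint e / Rg + e / (Rg * T)) * (M v - f v)
  - (e * M v - g v) / (Rg * T).

Lemma entropy_production_le v : entropy_production v <= equilibrium_production v.
Proof.
rewrite /entropy_production /equilibrium_production.
have M0 : 0 < M v by rewrite MintE maxwellian_gt0.
have [th0 eth] := inv_pos_range deint cv_gt0 (gf v).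
set eps := g v / f v in th0 eth *; set th := inv_pos eint eps in th0 eth *.
have -> : g v = eps * f v by rewrite divfK ?gt_eqF.
(* Concavity of [sint] used twice: the tangent at [eps] evaluated at [e], and the tangent at [e]
   evaluated at [eps]. *)
have c1 := entropy_tangent deint cv_gt0 dsint th0 T0.
have c2 := entropy_tangent deint cv_gt0 dsint T0 th0.
rewrite eth -/e in c1 c2.
have lnm : (ln (f v) - ln (M v)) * (M v - f v) <= 0.
  case: (leP (f v) (M v)) => h.
    by rewrite mulr_le0_ge0 ?subr_ge0// subr_le0 ler_ln ?posrE.
  by rewrite mulr_ge0_le0 ?subr_le0 ?(ltW h)// subr_ge0 ler_ln ?posrE ?(ltW h).
rewrite -subr_le0.
(* Monotonicity of the gradient made explicit: the gap is a logarithmic term plus the two tangent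
   defects, weighted by [M v] and [f v], and each of these is nonpositive. *)
have -> : (ln (f v) + 1 - sint eps / Rg + eps / (Rg * th)) * (M v - f v) -
  (e * M v - eps * f v) / (Rg * th) -
  ((ln (M v) + 1 - sint e / Rg + e / (Rg * T)) * (M v - f v) -
   (e * M v - eps * f v) / (Rg * T)) =
  (ln (f v) - ln (M v)) * (M v - f v) +
  Rg^-1 * (M v * (sint e - sint eps - (e - eps) / th) +
           f v * (sint eps - sint e - (eps - e) / T)).
  by field; rewrite !gt_eqF.
have h1 : M v * (sint e - sint eps - (e - eps) / th) <= 0.
  by rewrite mulr_ge0_le0 ?subr_le0 ?(ltW M0).
have h2 : f v * (sint eps - sint e - (eps - e) / T) <= 0.
  by rewrite mulr_ge0_le0 ?subr_le0 ?(ltW (f0 v)).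
rewrite -[leRHS]addr0 lerD// mulr_ge0_le0 ?invr_ge0 ?(ltW Rg0)//.
by rewrite -[leRHS]addr0 lerD.
Qed.

Lemma vint_equilibrium_production :
  vintegrable equilibrium_production /\ vint equilibrium_production = 0.
Proof.
pose C := ln (density f / (2 * pi * (Rg * T)) `^ (3 / 2)) + 1 - sint e / Rg.
have [iM vM] := vint_maxwellian (density f) u RT0.
have [iS vS] := vint_sqnorm_maxwellian (density f) u RT0.
rewrite -MintE in iM vM iS vS.
(* The logarithm of [M] is a constant minus [sqnorm (v - u) / (2 * (Rg * T))], and the terms in
   [e * M] cancel. Hence [M] enters only through its mass and second moment. *)
have E : equilibrium_production = (fun v =>
   (C * M v + - C * f v) + (- (2 * (Rg * T))^-1 * (sqnorm (v - u) * M v)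
   + (Rg * T)^-1 * (sqnorm (v - u) / 2 * f v)) +
   (- (e / (Rg * T)) * f v + (Rg * T)^-1 * g v)).
  apply/funext => v; rewrite /equilibrium_production {1}MintE ln_maxwellian// /C.
  by field; rewrite !gt_eqF.
have i1 := vintegrableZ C iM; have i2 := vintegrableZ (- C) intf.
have i3 := vintegrableZ (- (2 * (Rg * T))^-1) iS.
have i4 := vintegrableZ (Rg * T)^-1 intE.
have i5 := vintegrableZ (- (e / (Rg * T))) intf.
have i6 := vintegrableZ (Rg * T)^-1 intg.
have i12 := vintegrableD i1 i2; have i34 := vintegrableD i3 i4.
have i56 := vintegrableD i5 i6; have i1234 := vintegrableD i12 i34.
rewrite E; split; first exact: vintegrableD.
rewrite (vintD i1234 i56) (vintD i12 i34) (vintD i1 i2) (vintD i3 i4) (vintD i5 i6).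
rewrite (vintZ _ iM) (vintZ _ intf) (vintZ _ iS) (vintZ _ intE) (vintZ _ intf)
  (vintZ _ intg) vM vS -/(density f).
have [_] := temperatureP; rewrite -/T /etot -/e /energy -/u => En.
(* The equation defining the temperature, solved for [vint g]. With the second moment
   [3 * rho * Rg * T] of [M], it makes the energy terms cancel. *)
have vg : vint g = (3 / 2 * Rg * T + e) * density f
    - vint (fun v => sqnorm (v - u) / 2 * f v).
  by rewrite En divfK ?gt_eqF// addrC addKr.
by rewrite vg; field; rewrite !gt_eqF.
Qed.

Lemma vint_entropy_production_le0 : vintegrable entropy_production ->
  vint entropy_production <= 0.
Proof.
move=> iP; have [iE <-] := vint_equilibrium_production.
by apply: le_vint => // v; exact: entropy_production_le.
Qed.

End local_equilibrium.

(** * Differential calculus along a filter, common to time and space derivatives *)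

Section difference_quotients.
Context {R : realType}.
Variables (Fl : set_system R) (t : R).
Context {FF : ProperFilter Fl}.
Hypothesis Flt : Fl --> t.
Hypothesis Fl_neq : \forall s \near Fl, s != t.
Implicit Types a b : R -> R.

Lemma cvg_tquot_continuous a (da : R) : tquot a t s @[s --> Fl] --> da ->
  a s @[s --> Fl] --> a t.
Proof.
move=> cda.
have : a t + tquot a t s * (s - t) @[s --> Fl] --> a t + da * (t - t).
  apply: cvgD; first exact: cvg_cst.
  by apply: cvgM cda _; apply: cvgB Flt _; exact: cvg_cst.
rewrite subrr mulr0 addr0; apply: cvg_trans; apply: near_eq_cvg.
by near=> s; rewrite /tquot divfK ?subrKC// subr_eq0; near: s.
Unshelve. all: by end_near. Qed.

Lemma cvg_tquot_cst (k : R) : tquot (fun=> k) t s @[s --> Fl] --> (0 : R).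
Proof.
rewrite (_ : tquot _ t = cst 0); first exact: cvg_cst.
by apply/funext => s; rewrite /tquot subrr mul0r.
Qed.

Lemma cvg_tquotB a b (da db : R) : tquot a t s @[s --> Fl] --> da ->
  tquot b t s @[s --> Fl] --> db ->
  tquot (fun s => a s - b s) t s @[s --> Fl] --> da - db.
Proof.
move=> cda cdb; rewrite (_ : tquot _ t = fun s => tquot a t s - tquot b t s).
  exact: cvgB cda cdb.
by apply/funext => s; rewrite /tquot; ring.
Qed.

Lemma cvg_tquotM a b (da db : R) : tquot a t s @[s --> Fl] --> da ->
  tquot b t s @[s --> Fl] --> db ->
  tquot (fun s => a s * b s) t s @[s --> Fl] --> da * b t + a t * db.
Proof.
move=> cda cdb.
rewrite (_ : tquot _ t = fun s => tquot a t s * b s + a t * tquot b t s).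
  apply: cvgD; first exact: cvgM cda (cvg_tquot_continuous cdb).
  by apply: cvgM cdb; exact: cvg_cst.
by apply/funext => s; rewrite /tquot; ring.
Qed.

(** Carathéodory's form of the derivative factors the increment of [phi] without dividing by
    [a s - a t], which may vanish for [s] near [t]. *)
Lemma cvg_tquot_comp a (phi : R -> R) (da dphi : R) :
  is_derive (a t) 1 phi dphi -> tquot a t s @[s --> Fl] --> da ->
  tquot (fun s => phi (a s)) t s @[s --> Fl] --> dphi * da.
Proof.
move=> /is_derive1_caratheodory[q [qE qc <-]] cda.
rewrite (_ : tquot _ t = fun s => q (a s) * tquot a t s).
  by apply: (cvgM _ cda); exact: (continuous_cvg _ qc (cvg_tquot_continuous cda)).
by apply/funext => s; rewrite /tquot qE mulrA.
Qed.

Lemma cvg_tquot_Hdens (Rg : R) (sint : R -> R) a b (da db th : R) :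
  Rg != 0 -> th != 0 -> 0 < a t ->
  is_derive (b t / a t) 1 sint th^-1 ->
  tquot a t s @[s --> Fl] --> da -> tquot b t s @[s --> Fl] --> db ->
  tquot (fun s => a s * ln (a s) - a s / Rg * sint (b s / a s)) t s @[s --> Fl] -->
    (ln (a t) + 1 - sint (b t / a t) / Rg + b t / a t / (Rg * th)) * da
    - (Rg * th)^-1 * db.
Proof.
move=> R0 th0 a0 ds cda cdb.
have cln := cvg_tquot_comp (is_derive1_ln a0) cda.
have dV : is_derive (a t) 1 (fun x : R => x^-1) (- (a t ^- 2)).
  have := @is_deriveV _ (fun y : R => y) (a t) 1 1 (lt0r_neq0 a0) (is_derive_id _ _).
  by move/is_derive_eq; apply; rewrite /GRing.scale/= mulr1.
have cV := cvg_tquot_comp dV cda.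
have cs := cvg_tquot_comp ds (cvg_tquotM cdb cV).
have cR := cvg_tquot_cst Rg^-1.
(* The limit as the product and chain rules deliver it, with [b / a] read as [b] times the inverse
   of [a] and division by [Rg] as multiplication by a constant. *)
rewrite (_ : _ - _ = da * ln (a t) + a t * ((a t)^-1 * da) -
  ((da / Rg + a t * 0) * sint (b t / a t) +
   a t / Rg * (th^-1 * (db / a t + b t * (- a t ^- 2 * da))))).
  exact: cvg_tquotB (cvg_tquotM cda cln) (cvg_tquotM (cvg_tquotM cda cR) cs).
by field; rewrite R0 th0 lt0r_neq0.
Qed.

End difference_quotients.

(** * Time and space derivatives as limits of difference quotients *)

Section phase_derivatives.
Context {R : realType}.

(** Times just to the right of [t] remain nonnegative even when [t = 0], so every set of [tnear t]
    belongs to the proper filter at the right of [t]. Properness makes the limits unique. *)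
Lemma tnear_proper (t : R) : 0 <= t -> ProperFilter (tnear t).
Proof.
move=> t0.
have sub P : tnear t P -> (t^'+)%classic P.
  rewrite /tnear /at_right /within /dnbhs/=.
  move=> h; apply: (@filterS _ (nbhs t) _ _ _ _ h) => s + ts.
  apply; first by rewrite gt_eqF.
  exact: ltW (le_lt_trans t0 ts).
split; last exact: within_filter.
by move=> /sub; exact: filter_not_empty.
Qed.

Lemma cvg_tnear (t : R) : tnear t --> t.
Proof. by move=> P h; apply: (@filterS _ (nbhs t) _ _ _ _ h) => s Ps _ _. Qed.

Lemma tnear_neq (t : R) : \forall s \near tnear t, s != t.
Proof. by rewrite /tnear /within /dnbhs /prop_near1 /=; apply: nearW. Qed.

Lemma dtE (f : R -> R) t (l : R) : 0 <= t ->
  tquot f t s @[s --> tnear t] --> l -> dt f t = l.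
Proof. by move=> /tnear_proper t0; exact: cvg_lim. Qed.

Lemma tquot_line (f : 'rV[R]_3 -> R) (x v : 'rV[R]_3) :
  tquot (fun h => f (h *: v + x)) 0 =
  (fun h => h^-1 *: ((f \o shift x) (h *: v) - f x)).
Proof.
by apply/funext => h; rewrite /tquot scale0r add0r subr0 mulrC.
Qed.

Lemma cvg_tquot_dx (f : 'rV[R]_3 -> R) x i : xderivable f x i ->
  tquot (fun h => f (h *: delta_mx ord0 i + x)) 0 h @[h --> 0^'] --> dx i f x.
Proof. by rewrite tquot_line. Qed.

Lemma dxE (f : 'rV[R]_3 -> R) x i (l : R) :
  tquot (fun h => f (h *: delta_mx ord0 i + x)) 0 h @[h --> 0^'] --> l ->
  dx i f x = l.
Proof. by rewrite tquot_line; exact: cvg_lim. Qed.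

End phase_derivatives.

(** * Chain rule for the entropy density along the transport operator *)

Section entropy_transport.
Context {R : realType}.
Variables (Rg : R) (eint sint : R -> R).
Variables F G : R -> 'rV[R]_3 -> 'rV[R]_3 -> R.
Hypothesis Rg0 : 0 < Rg.
Hypothesis deint : forall T : R, 0 < T -> derivable eint T 1.
Hypothesis cv_gt0 : forall T : R, 0 < T -> 0 < derive1 eint T.
Hypothesis dsint : forall eps : R, energy_range eint eps ->
  is_derive eps 1 sint (inv_pos eint eps)^-1.
Hypotheses (F1 : C1_phase F) (G1 : C1_phase G).
Hypothesis F0 : forall (t : R) (x v : 'rV[R]_3), 0 <= t -> 0 < F t x v.
Hypothesis GF : forall (t : R) (x v : 'rV[R]_3), 0 <= t ->
  energy_range eint (G t x v / F t x v).
Local Notation H t x := (Hdens Rg (F t x) (G t x) sint).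

(** The time derivative and each space derivative involve the same gradient of the entropy density,
    so they recombine into the transport of [F] and of [G]. *)
Lemma transport_Hdens t x v : 0 <= t ->
  let eps := G t x v / F t x v in let th := inv_pos eint eps in
  dt (fun s => H s x v) t
  + \sum_(i < 3) dx i (fun y => v ord0 i * H t y v) x =
  (ln (F t x v) + 1 - sint eps / Rg + eps / (Rg * th)) * transport F t x v
  - (Rg * th)^-1 * transport G t x v.
Proof.
move=> t0 eps th.
have [th0 _] := inv_pos_range deint cv_gt0 (GF x v t0).
have Rn0 := lt0r_neq0 Rg0; have thn0 := lt0r_neq0 th0.
have [_ /(_ t x v t0) [dtF dxF] _ _ _] := F1.
have [_ /(_ t x v t0) [dtG dxG] _ _ _] := G1.
have PF := tnear_proper t0.
rewrite (dtE t0 (cvg_tquot_Hdens (@cvg_tnear _ t) (@tnear_neq _ t) Rn0 thn0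
  (F0 x v t0) (dsint (GF x v t0)) dtF dtG)).
have dxH i : dx i (fun y => v ord0 i * H t y v) x = v ord0 i *
   ((ln (F t x v) + 1 - sint eps / Rg + eps / (Rg * th)) * dx i (fun y => F t y v) x
   - (Rg * th)^-1 * dx i (fun y => G t y v) x).
  have p0 : 0 *: delta_mx ord0 i + x = x by rewrite scale0r add0r.
  have P0 : ProperFilter (0 : R)^' by exact: Proper_dnbhs_numFieldType.
  have c0 : (0 : R)^' --> (0 : R) by exact: cvg_within.
  have n0 : \forall h \near (0 : R)^', h != 0 by exact: nbhs_dnbhs_neq.
  (* On the line through [x] in the direction of coordinate [i], the partial derivative is a
     quotient at [0], and the rule used for time applies. *)
  have := @cvg_tquot_Hdens R 0^' 0 P0 c0 n0 Rg sint
    (fun h => F t (h *: delta_mx ord0 i + x) v)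
    (fun h => G t (h *: delta_mx ord0 i + x) v) _ _ th Rn0 thn0.
  rewrite p0 => /(_ _ _ (F0 x v t0) (dsint (GF x v t0))
    (cvg_tquot_dx (proj1 (dxF i))) (cvg_tquot_dx (proj1 (dxG i)))) cH.
  apply: dxE.
  have := cvg_tquotM (FF := P0) c0 n0 (cvg_tquot_cst (FF := P0) 0 (v ord0 i)) cH.
  by rewrite mul0r add0r.
under eq_bigr do rewrite dxH.
rewrite /transport !mulrDr !mulr_sumr opprD addrACA -!sumrN -big_split/=.
by congr (_ + _); apply: eq_bigr => i _; ring.
Qed.

End entropy_transport.

Theorem proposition3p1 (R : realType) (Rg : R) (eint sint : R -> R)
    (tau : R -> 'rV[R]_3 -> R) (F G : R -> 'rV[R]_3 -> 'rV[R]_3 -> R)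
    (hRg : 0 < Rg)
    (heint_derivable : forall T : R, 0 < T -> derivable eint T 1)
    (heint_C1 : forall T : R, 0 < T -> {for T, continuous (derive1 eint)})
    (hcv : forall T : R, 0 < T -> 0 < derive1 eint T)
    (hsint : forall eps : R, energy_range eint eps ->
       is_derive eps 1 sint (inv_pos eint eps)^-1)
    (htau : forall (t : R) (x : 'rV[R]_3), 0 <= t -> 0 < tau t x)
    (hF_C1 : C1_phase F) (hG_C1 : C1_phase G)
    (hF_pos : forall (t : R) (x v : 'rV[R]_3), 0 <= t -> 0 < F t x v)
    (hGF : forall (t : R) (x v : 'rV[R]_3), 0 <= t -> energy_range eint (G t x v / F t x v))
    (hreg : regular Rg F G sint)
    (hBGK : reduced_BGK Rg eint F G tau) :
  forall (t : R) (x : 'rV[R]_3), 0 <= t ->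
    dt (fun s => vint (Hdens Rg (F s x) (G s x) sint)) t
    + \sum_(i < 3)
        dx i (fun y => vint (fun v => v ord0 i * Hdens Rg (F t y) (G t y) sint v)) x
    <= 0.
Proof.
move=> t x t0.
have [[iF iG] [_ iE] _ [idt _ dtH] hx] := hreg t x t0.
have tau0 := htau t x t0.
have idx i : vintegrable (fun v =>
    dx i (fun y => v ord0 i * Hdens Rg (F t y) (G t y) sint v) x).
  by have [] := hx i.
have iS := vintegrable_sum (index_enum 'I_3) idx.
rewrite dtH (eq_bigr (fun i => vint (fun v =>
  dx i (fun y => v ord0 i * Hdens Rg (F t y) (G t y) sint v) x))); last first.
  by move=> i _; have [] := hx i.
rewrite -vint_sum// -vintD//.
(* The two equations replace the transport terms. The factor [(tau t x)^-1] does not depend on [v],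
   so it leaves the integral and preserves its sign. *)
have E v : dt (fun s => Hdens Rg (F s x) (G s x) sint v) t +
    \sum_(i < 3) dx i (fun y => v ord0 i * Hdens Rg (F t y) (G t y) sint v) x =
    (tau t x)^-1 * entropy_production Rg eint (F t x) (G t x) sint v.
  rewrite (transport_Hdens hRg heint_derivable hcv hsint hF_C1 hG_C1 hF_pos hGF)//.
  have [-> ->] := hBGK t x v t0.
  by rewrite /entropy_production; ring.
(* Integrability is inherited from the differentiated entropy and flux, multiplied back by
   [tau t x]. *)
have iP : vintegrable (entropy_production Rg eint (F t x) (G t x) sint).
  have := vintegrableZ (tau t x) (vintegrableD idt iS).
  congr (vintegrable _); apply/funext => v.
  by rewrite E mulVKf ?gt_eqF.
rewrite (funext E) vintZ// pmulr_rle0 ?invr_gt0//.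
apply: (vint_entropy_production_le0 hRg heint_derivable hcv) => //.
- by move=> v; exact: hF_pos.
- by move=> v; exact: hGF.
Qed.
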